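(* Let $X$ be a separable Fréchet space with an unconditional basis $(e_n)_{n \in \mathbb{N}}$ and let $w(i)=(w_n(i))_{n\in\mathbb{N}}$, $i\in \mathbb{N}$, be countably many weights for which every $B_{w(i)}$, $i\in \mathbb{N}$, is a continuous operator on $X$. Assume that there exist a weight $\omega=(\omega_n)_{n\in\mathbb{N}}$, constants $M\geq 1$ and $0<\eta \leq 1$ with either $M=\eta=1$ or ($M\neq 1$ and $\eta\neq 1$), and a constant $C>0$, such that for any $i\in \mathbb{N}$ and any $n\geq 0$, $m\geq 1$: (i) the series $\sum_{k \geq 1}(\omega_1\cdots\omega_{k})^{-1}e_{k}$ is unconditionally convergent in $X$; (ii) $\vert \omega_n\cdots \omega_{n+m} \vert \leq C\eta^m \vert w_n(i)\cdots w_{n+m}(i) \vert$; (iii) $C^{-1}M ^{-m}\leq \vert w_n(i)\cdots w_{n+m}(i) \vert \leq CM^m$. Then there exists a common frequently hypercyclic vector for the family $(B_{w(i)})_{i\in \mathbb{N}}$.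
   Context: $\mathbb{N}=\{0,1,2,\ldots\}$. A weight is a sequence of nonzero real numbers. For a weight $w=(w_n)_{n\in\mathbb{N}}$, the weighted shift $B_w$ is defined for $x=\sum_{n\geq 0}x_ne_n\in X$ by $B_w(x)=\sum_{n\geq 0}w_{n+1}x_{n+1}e_n$; equivalently $B_w(e_n)=w_ne_{n-1}$ for $n\ge 0$ with the convention $e_{-1}=0$. A vector $x\in X$ is frequently hypercyclic for a continuous linear operator $T$ on $X$ if for every non-empty open $U\subset X$, $\underline{d}(\{n\in\mathbb{N}:T^n(x)\in U\})>0$, where $\underline{d}(E)=\liminf_{n\to\infty}\frac{\mathrm{card}([0,n]\cap E)}{n+1}$. A common frequently hypercyclic vector for a family is a vector frequently hypercyclic for each operator of the family. *)

(* Defs.v *)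
From HB Require Import structures.
From mathcomp Require Import all_boot all_order all_algebra.
From mathcomp Require Import all_classical all_reals all_analysis.
From mathcomp Require Import complex.

Set Implicit Arguments.
Unset Strict Implicit.
Unset Printing Implicit Defensive.

Import Order.TTheory GRing.Theory Num.Theory.
Import numFieldNormedType.Exports.

Local Open Scope classical_set_scope.
Local Open Scope ring_scope.

(* Spaces are over the real or the complex field; weights are real in both
   cases. *)
Inductive scalars := RealScalars | ComplexScalars.

Definition scalar_field (R : realType) (s : scalars) : numFieldType :=
  match s with
  | RealScalars => R
  | ComplexScalars => R[i]
  end.

Definition of_real (R : realType) (s : scalars) : R -> scalar_field R s :=
  match s return R -> scalar_field R s with
  | RealScalars => id
  | ComplexScalars => real_complex R
  end.

(* The topology of X is induced by d, and d is a complete metric invariant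
   under translations. [tvsType] does not relate the uniformity of X to its
   linear structure, so completeness is not stated through that uniformity. *)
Definition complete_invariant_metric (R : realType) (K : numFieldType)
    (X : tvsType K) (d : X -> X -> R) : Prop :=
  [/\ [/\ forall x y, 0 <= d x y,
          forall x y, d x y = 0 <-> x = y,
          forall x y, d x y = d y x &
          forall x y z, d x z <= d x y + d y z],
      forall x y z, d (x + z) (y + z) = d x y,
      forall (x : X) (U : set X),
        nbhs x U <-> exists2 r : R, 0 < r & [set y | d x y < r] `<=` U &
      forall u : nat -> X,
        (forall r : R, 0 < r -> exists N : nat, forall m n : nat,
          (N <= m)%N -> (N <= n)%N -> d (u m) (u n) < r) ->
        exists x : X, u @ \oo --> x].

(* Local convexity is part of [tvsType]. *)
Definition frechet (R : realType) (K : numFieldType) (X : tvsType K) : Prop :=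
  exists d : X -> X -> R, complete_invariant_metric d.

Definition separable (X : topologicalType) : Prop :=
  exists2 D : set X, countable D & dense D.

Definition unconditionally_convergent (K : numFieldType) (X : tvsType K)
    (u : nat -> X) : Prop :=
  forall s : nat -> nat, bijective s ->
    exists x : X, series (u \o s) @ \oo --> x.

Definition expansion (K : numFieldType) (X : tvsType K)
    (e : nat -> X) (a : nat -> K) (x : X) : Prop :=
  series (fun n => a n *: e n) @ \oo --> x.

Definition unconditional_basis (K : numFieldType) (X : tvsType K)
    (e : nat -> X) : Prop :=
  (forall x, exists! a : nat -> K, expansion e a x) /\
  (forall x a, expansion e a x ->
    unconditionally_convergent (fun n => a n *: e n)).

Definition weight (R : realType) (w : nat -> R) : Prop :=
  forall n, w n != 0.

(* For a basis e, this determines B: it is the shift B_w. *)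
Definition is_weighted_shift (R : realType) (s : scalars)
    (X : tvsType (scalar_field R s)) (e : nat -> X) (w : nat -> R)
    (B : X -> X) : Prop :=
  forall x a, expansion e a x ->
    expansion e (fun n => of_real s (w n.+1) * a n.+1) (B x).

Definition lower_density (R : realType) (E : set nat) : \bar R :=
  limn_einf
    (fun n => (#|[pred k : 'I_n.+1 | (k : nat) \in E]|%:R / n.+1%:R)%:E).

Definition frequently_hypercyclic (R : realType) (X : topologicalType)
    (T : X -> X) (x : X) : Prop :=
  forall U : set X, open U -> U !=set0 ->
    (0 < lower_density R [set n | U (iter n T x)])%E.

(* Main.v *)
Require Import Defs.
From HB Require Import structures.
From mathcomp Require Import all_boot all_order all_algebra.
From mathcomp Require Import all_classical all_reals all_analysis.
From mathcomp Require Import complex zify ring lra.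

(** Write B_i for the shift of weight w(i) and S_i for its right inverse
    e_k |-> e_(k+1) / w_(k+1)(i). Finite linear combinations Y_c of the e_k are
    dense; enumerate pairs (operator i = op c, combination Y_c) so that each pair
    recurs for arbitrarily large codes c. The common vector is
      x = \sum_c \sum_(m in A_c) S_(op c)^m Y_c,
    where the A_c are disjoint sets of positive lower density. If n is in A_c and
    i = op c, then B_i^n x = Y_c + \sum_(q, m) B_i^n S_(op q)^m Y_q over the other
    pairs with m in A_q. It suffices that this remainder be as small as desired
    for large c, because then B_i^n x visits a given open set for all n in some
    A_c with op c = i.

    If all the distances between the A_c are large, the terms with m < n vanish,
    and those with m > n only occupy coordinates l >= m - n. Their coefficient at
    e_l involves the quotient of the products of w(i) and of w(op q) over
    ]l, l + n], times the inverse of a product of w(op q) over ]k, l] with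
    l = k + m - n. By (ii) the latter is O(eta^(m-n)) times Omega_k / Omega_l,
    where Omega_l = omega_1 ... omega_l. The quotient is 1 if i = op q; otherwise
    (iii) only bounds it by C^2 M^(2n), and the factor eta^(m-n) must absorb this.
    Hence different A_c should live on different scales: c <> q and n < m should
    force m >= (r+1) n, with r such that M^2 eta^r <= 1 (geometric_domination).
    The sets A_c (sparse_set) are arithmetic progressions in the intervals
    [a^k, 2 a^k[, where the label of k, the 2-adic valuation of k + 1, is c. Each
    label recurs with bounded gaps, so the densities are positive.

    The remainder thus has coefficients O(D_q) / Omega_l at e_l, with a constant
    D_q depending on the combination Y_q that occupies l. Unconditional
    convergence of \sum_l e_l / Omega_l provides a function g tending to infinity
    such that sums of t_l e_l / Omega_l with |t_l| <= g(l) have uniformly small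
    tails (unconditional_growth). If A_q starts, and keeps its distances, beyond
    the point N_q after which g exceeds D_q, the remainder is such a tail, and so
    is the series of x itself (universal_coefficients). *)

Set Implicit Arguments.
Unset Strict Implicit.
Unset Printing Implicit Defensive.

Import Order.TTheory GRing.Theory Num.Theory.
Import numFieldNormedType.Exports.

Local Open Scope classical_set_scope.
Local Open Scope ring_scope.

(** * Sparse sets of positive lower density *)

Lemma lower_density_gt0 (R : realType) (E : set nat) (L n0 : nat) :
  (forall n, (n0 <= n)%N ->
    (n.+1 <= L * #|[pred k : 'I_n.+1 | (k : nat) \in E]|)%N) ->
  (0 < lower_density R E)%E.
Proof.
move=> EL; have L0 : (0 < L)%N by have := EL _ (leqnn _); case: L {EL}.
have [e_gt0 e_le] : 0 < (L%:R^-1 : R) /\ ((L%:R^-1)%:E <= lower_density R E)%E.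
  split; first by rewrite invr_gt0 ltr0n.
  rewrite /lower_density limn_einf_lim.
  apply: lime_ge; first exact: is_cvg_einfs.
  exists n0 => // n /= n0n; apply: le_ereal_inf_tmp => _ [m /= nm <-].
  rewrite lee_fin ler_pdivlMr ?ltr0n// mulrC ler_pdivrMr ?ltr0n//.
  by rewrite -natrM ler_nat mulnC EL// (leq_trans n0n).
by rewrite (lt_le_trans _ e_le)// lte_fin.
Qed.

Lemma lower_density_subset (R : realType) (E F : set nat) :
  E `<=` F -> (lower_density R E <= lower_density R F)%E.
Proof.
move=> EF; rewrite /lower_density !limn_einf_lim.
apply: lee_lim; [exact: is_cvg_einfs|exact: is_cvg_einfs|].
apply: nearW => n; apply: le_ereal_inf_tmp => _ [m /= nm <-].
apply: le_trans (ereal_inf_lbound _) _; first by exists m.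
rewrite lee_fin ler_wpM2r// ler_nat; apply: subset_leq_card.
by apply/fintype.subsetP => k; rewrite !inE => /EF.
Qed.

(** The integers j whose successor has 2-adic valuation c form the arithmetic
    progression of step 2^(c+1) through 2^c - 1. *)
Lemma dyadic_label_syndetic (c k : nat) : (2 ^ c.+1 <= k)%N ->
  exists2 j, (j <= k < j + 2 ^ c.+1)%N & logn 2 j.+1 = c.
Proof.
move=> ck; pose t := ((k.+1 - 2 ^ c) %/ 2 ^ c.+1)%N.
have ck' : (2 ^ c <= k.+1)%N by rewrite expnS in ck; lia.
exists (2 ^ c * (2 * t).+1).-1; last first.
  rewrite prednK ?muln_gt0 ?expn_gt0// lognM ?expn_gt0// pfactorK//.
  by rewrite lognE dvdn2 /= mul2n odd_double /= addn0.
have := divn_eq (k.+1 - 2 ^ c) (2 ^ c.+1); rewrite -/t.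
have := ltn_mod (k.+1 - 2 ^ c) (2 ^ c.+1); rewrite expn_gt0 /=.
have : (0 < 2 ^ c)%N by rewrite expn_gt0.
rewrite expnS; set z := (2 ^ c)%N in ck' *; set u := (_ %% _)%N.
nia.
Qed.


(** The progression of step a^h in [a^k, 2 a^k[. A power of a as step makes the
    number of terms exactly a^(k-h), a fixed proportion of a^k. *)
Definition sparse_block (a h k : nat) : set nat :=
  [set n | exists2 t, (t < a ^ (k - h))%N & n = (a ^ k + t * a ^ h)%N].

(** The step a^(N c) exceeds N c, so consecutive elements of a block are more than
    N c apart; starting after block N c separates the set from the blocks of
    smaller scale. *)
Definition sparse_set (a : nat) (N : nat -> nat) (c : nat) : set nat :=
  [set n | exists k, [/\ logn 2 k.+1 = c, (N c < k)%N &
    sparse_block a (N c) k n]].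

Section SparseSets.
Context (a : nat) (N : nat -> nat).
Hypothesis a_ge4 : (4 <= a)%N.

Let a_gt1 : (1 < a)%N. Proof. lia. Qed.

Lemma sparse_block_bounds h k n : (h <= k)%N -> sparse_block a h k n ->
  (a ^ k <= n < 2 * a ^ k)%N.
Proof.
move=> hk [t ta ->]; rewrite leq_addr mul2n -addnn ltn_add2l.
by rewrite -[X in (_ < a ^ X)%N](subnK hk) expnD ltn_pmul2r// expn_gt0; lia.
Qed.

(** As a >= 2, the intervals [a^k, 2 a^k[ follow each other without overlap. *)
Lemma sparse_block_mono k l n m :
  (a ^ k <= n)%N -> (m < 2 * a ^ l)%N -> (n <= m)%N -> (k <= l)%N.
Proof.
move=> kn ml nm; rewrite leqNgt; apply/negP => lk.
have : (a ^ l.+1 <= a ^ k)%N by rewrite leq_exp2l.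
by rewrite expnS; nia.
Qed.

Lemma sparse_set_ge c n : sparse_set a N c n -> (N c <= n)%N.
Proof.
move=> [k [_ Nk /(sparse_block_bounds (ltnW Nk))/andP[kn _]]].
apply: leq_trans kn.
by apply: leq_trans (ltnW Nk) _; exact/ltnW/ltn_expl.
Qed.

Lemma sparse_set_disjoint c c' n :
  sparse_set a N c n -> sparse_set a N c' n -> c = c'.
Proof.
move=> [k [<- Nk /(sparse_block_bounds (ltnW Nk))/andP[kn nk]]].
move=> [l [<- Nl /(sparse_block_bounds (ltnW Nl))/andP[ln nl]]].
suff -> : k = l by [].
by apply/eqP; rewrite eqn_leq (sparse_block_mono kn nl)// (sparse_block_mono ln nk).
Qed.

(** Two elements of one block differ by a multiple of the step a^(N c). In blocks
    k < l, the distance is at least a^l - 2 a^k >= 2 a^(l-1), which dominates both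
    thresholds because N c < k and N c' < l. *)
Lemma sparse_set_gap c c' n m :
  sparse_set a N c n -> sparse_set a N c' m -> (n < m)%N ->
  (n + maxn (N c) (N c') <= m)%N.
Proof.
move=> [k [kc Nk Bn]] [l [lc Nl Bm]] nm.
have /andP[kn nk] := sparse_block_bounds (ltnW Nk) Bn.
have /andP[lm ml] := sparse_block_bounds (ltnW Nl) Bm.
have := sparse_block_mono kn ml (ltnW nm).
rewrite leq_eqVlt => /predU1P[kl|kl].
  have cc' : c' = c by rewrite -kc -lc kl.
  rewrite cc' maxnn; move: Bn Bm => [t _ En] [u _ Em].
  move: nm; rewrite En Em cc' kl ltn_add2l ltn_pmul2r ?expn_gt0 ?(ltnW a_gt1)// => tu.
  have := ltn_expl (N c) a_gt1; set z := (a ^ N c)%N; nia.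
have := leq_pexp2l (ltnW a_gt1) kl; rewrite expnS => akl.
have : (l.-1 < a ^ l.-1)%N := ltn_expl _ a_gt1.
have : (k < a ^ k)%N := ltn_expl _ a_gt1.
have : (a ^ k <= a ^ l.-1)%N by rewrite leq_pexp2l//; lia.
have : (a ^ l = a * a ^ l.-1)%N by rewrite -expnS prednK//; lia.
rewrite addn_maxr geq_max.
set u := (a ^ l)%N in lm *; set v := (a ^ l.-1)%N.
by set z := (a ^ k)%N in nk *; nia.
Qed.

(** Different labels mean blocks k < l, and n < 2 a^k while m >= a^l. *)
Lemma sparse_set_ratio c c' n m :
  sparse_set a N c n -> sparse_set a N c' m -> (n < m)%N -> c != c' ->
  (a * n <= 2 * m)%N.
Proof.
move=> [k [kc Nk Bn]] [l [lc Nl Bm]] nm /eqP cc'.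
have /andP[kn nk] := sparse_block_bounds (ltnW Nk) Bn.
have /andP[lm ml] := sparse_block_bounds (ltnW Nl) Bm.
have := sparse_block_mono kn ml (ltnW nm).
rewrite leq_eqVlt => /predU1P[kl|kl]; first by rewrite -kc -lc kl in cc'.
have := leq_pexp2l (ltnW a_gt1) kl; rewrite expnS; nia.
Qed.

(** Below n, look at the last few complete blocks: one of 2^(c+1) consecutive ones
    has label c, and its a^(j-h) elements are a proportion of n bounded below. *)
Lemma sparse_set_lower_density (R : realType) c :
  (0 < lower_density R (sparse_set a N c))%E.
Proof.
set h := N c; set w := (2 ^ c.+1)%N.
have a0 b : (0 < a ^ b)%N by rewrite expn_gt0 (ltnW a_gt1).
apply: (@lower_density_gt0 _ _ (a ^ (h + w + 1)) (a ^ (h + w + 2))) => n n0n.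
have n_gt0 : (0 < n)%N by apply: leq_trans n0n.
pose k := (trunc_log a n).-1.
have kE : trunc_log a n = k.+1.
  rewrite prednK// trunc_log_gt0 a_gt1/=; apply: leq_trans n0n.
  rewrite (ltn_predK a_gt1) -[X in (X <= _)%N]expn1.
  by rewrite leq_pexp2l ?(ltnW a_gt1)//; lia.
have /andP[kn nk] := trunc_log_bounds a_gt1 n_gt0; rewrite kE in kn nk.
have hk : (h + w < k)%N.
  suff : (h + w + 2 < k.+2)%N by rewrite addn2.
  by rewrite -(ltn_exp2l _ _ a_gt1); exact: leq_ltn_trans nk.
have wk : (w <= k)%N by lia.
have [j /andP[jk kj] jc] := dyadic_label_syndetic wk.
rewrite -/w in kj; have hj : (h < j)%N by lia.
have count_le : (a ^ (j - h) <= #|[pred k : 'I_n.+1 | (k : nat) \in sparse_set a N c]|)%N.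
  pose f (t : 'I_(a ^ (j - h))) : 'I_n.+1 := inord (a ^ j + t * a ^ h).
  have fE t : f t = (a ^ j + t * a ^ h)%N :> nat.
    rewrite inordK// ltnS; apply: leq_trans kn.
    have /andP[_ /ltnW] : (a ^ j <= a ^ j + t * a ^ h < 2 * a ^ j)%N.
      by apply: sparse_block_bounds (ltnW hj) _; exists (t : nat).
    move=> /leq_trans; apply; apply: (@leq_trans (a ^ j.+1)).
      by rewrite expnS leq_mul2r a_gt1 orbT.
    by rewrite leq_pexp2l ?(ltnW a_gt1).
  have f_inj : injective f.
    move=> t u /(congr1 val); rewrite /= !fE => /eqP.
    rewrite eqn_add2l eqn_mul2r eqn0Ngt a0 /= => /eqP tu.
    exact: val_inj.
  rewrite -[X in (X <= _)%N]card_ord -(card_codom f_inj).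
  apply: subset_leq_card; apply/fintype.subsetP => _ /codomP[t ->].
  rewrite !inE/= fE; exists j; split=> //.
  by exists (t : nat).
apply: leq_trans nk _; apply: leq_trans (_ : a ^ (h + w + 1) * a ^ (j - h) <= _)%N.
  by rewrite -expnD leq_pexp2l ?(ltnW a_gt1)//; lia.
by rewrite leq_mul2l count_le orbT.
Qed.

End SparseSets.

(** * Unconditionally convergent series *)

Lemma blockP (M : nat -> nat) : M 0%N = 0%N -> (forall k, (M k < M k.+1)%N) ->
  forall n, exists k, (M k <= n < M k.+1)%N.
Proof.
move=> M0 Minc; elim=> [|n [k /andP[kn nk]]].
  by exists 0%N; rewrite M0 /= -[X in (X < _)%N]M0.
have [nk'|nk'] := ltnP n.+1 (M k.+1); first by exists k; rewrite nk' ltnW.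
exists k.+1; rewrite nk' /=; apply: leq_ltn_trans nk _; exact: Minc.
Qed.

Lemma block_uniq (M : nat -> nat) : (forall k, (M k < M k.+1)%N) ->
  forall n k l, (M k <= n < M k.+1)%N -> (M l <= n < M l.+1)%N -> k = l.
Proof.
move=> Minc n k l /andP[kn nk] /andP[ln nl].
have mono : {homo M : x y / (x <= y)%N}.
  by apply: homo_leq => //; [exact: leq_trans|move=> i; exact/ltnW].
by case: (ltngtP k l) => // /mono; lia.
Qed.

(** Permute each interval [M k, M (k+1)[ so that the indices selected by b k come
    first; the subsum over the selected indices is then a difference of two partial
    sums of the rearranged series. *)
Lemma block_permutation (V : nmodType) (u : nat -> V) (M : nat -> nat)
    (b : nat -> pred nat) :
  M 0%N = 0%N -> (forall k, (M k < M k.+1)%N) ->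
  exists2 s : nat -> nat, bijective s &
    forall k, exists2 q, (M k <= q)%N &
      \sum_(M k <= j < q) u (s j) = \sum_(M k <= l < M k.+1 | b k l) u l.
Proof.
move=> M0 Minc; have [B BP] := choice (blockP M0 Minc).
have BE n k : (M k <= n < M k.+1)%N -> B n = k.
  by move=> nk; exact: (block_uniq Minc (BP n) nk).
pose I k := index_iota (M k) (M k.+1).
pose L k := seq.filter (b k) (I k) ++ seq.filter (predC (b k)) (I k).
have LI k : perm_eq (L k) (I k) by rewrite perm_filterC.
have sizeL k : size (L k) = (M k.+1 - M k)%N by rewrite (perm_size (LI k)) size_iota.
have uniqL k : uniq (L k) by rewrite (perm_uniq (LI k)) iota_uniq.
have memL k l : (l \in L k) = (M k <= l < M k.+1)%N.
  by rewrite (perm_mem (LI k)) mem_index_iota.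
pose s n := nth 0%N (L (B n)) (n - M (B n)).
pose g l := (M (B l) + index l (L (B l)))%N.
have ltB n : (n - M (B n) < size (L (B n)))%N.
  by rewrite sizeL; have /andP[] := BP n; lia.
have Bs n : B (s n) = B n.
  by apply: BE; rewrite -memL; exact: mem_nth.
have Bg l : B (g l) = B l.
  apply: BE; rewrite /g leq_addr /=.
  have : (index l (L (B l)) < size (L (B l)))%N by rewrite index_mem memL.
  by rewrite sizeL; lia.
exists s.
  exists g => n; first by rewrite /g Bs index_uniq// subnKC//; have /andP[] := BP n.
  by rewrite /s Bg /g addKn nth_index// memL.
move=> k; set F := seq.filter (b k) (I k).
exists (M k + size F)%N; first exact: leq_addr.
rewrite -{1}(add0n (M k)) big_addn addKn -[RHS]big_filter -/(I k) -/F [RHS](big_nth 0%N).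
apply: eq_big_nat => i /andP[_ iF]; congr (u _).
have iL : (i < size (L k))%N by rewrite size_cat (leq_trans iF)// leq_addr.
have Bi : B (i + M k) = k by apply: BE; rewrite sizeL in iL; lia.
by rewrite /s Bi addnK nth_cat iF.
Qed.

Section InvariantMetric.
Context (R : realType) (K : numFieldType) (X : tvsType K) (d : X -> X -> R).
Hypothesis dP : complete_invariant_metric d.

Lemma metric_refl x : d x x = 0. Proof. by case: dP => -[_ /(_ x x)[_ ->]]. Qed.

Lemma metricC x y : d x y = d y x. Proof. by case: dP => -[]. Qed.

Lemma metric_trans_le y x z : d x z <= d x y + d y z.
Proof. by case: dP => -[]. Qed.

Lemma metricDr z x y : d (x + z) (y + z) = d x y. Proof. by case: dP. Qed.

Lemma metricB x y : d (x - y) 0 = d x y.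
Proof. by rewrite -(metricDr y) subrK add0r. Qed.

Lemma metricN x : d (- x) 0 = d x 0.
Proof. by rewrite -sub0r metricB metricC. Qed.

Lemma metricD0 x y : d (x + y) 0 <= d x 0 + d y 0.
Proof. by apply: le_trans (metric_trans_le y _ _) _; rewrite -{2}(add0r y) metricDr. Qed.

Lemma nbhs_metric x (U : set X) :
  nbhs x U <-> exists2 r : R, 0 < r & forall y, d x y < r -> U y.
Proof. by case: dP => _ _ + _; exact. Qed.

Lemma nbhs_metric_ball x r : 0 < r -> nbhs x [set y | d x y < r].
Proof. by move=> r0; apply/nbhs_metric; exists r. Qed.

Lemma cvg_metric (u : nat -> X) x :
  u @ \oo --> x <->
  forall r : R, 0 < r -> exists N, forall n, (N <= n)%N -> d x (u n) < r.
Proof.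
split=> [ux r r0|ur].
  by have [N _ NU] := ux _ (nbhs_metric_ball x r0); exists N => n; exact: NU.
move=> U /nbhs_metric[r r0 rU]; have [N Nr] := ur _ r0.
by exists N => // n /= /Nr /rU.
Qed.

Lemma metric_complete (u : nat -> X) :
  (forall r : R, 0 < r -> exists N, forall m n, (N <= m)%N -> (m <= n)%N ->
    d (u n) (u m) < r) -> exists x : X, u @ \oo --> x.
Proof.
move=> u_cauchy; case: dP => _ _ _; apply => r r0.
have [N Nr] := u_cauchy _ r0; exists N => m n Nm Nn.
have [mn|/ltnW nm] := leqP m n; last exact: Nr.
by rewrite metricC; exact: Nr.
Qed.

(** Otherwise there would be, arbitrarily far, finite sets of indices with subsums
    bounded away from 0; choosing them in consecutive intervals, block_permutation
    produces a rearrangement whose partial sums are not Cauchy. *)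
Lemma unconditional_small_subsums (u : nat -> X) :
  unconditionally_convergent u -> forall r : R, 0 < r ->
  exists N, forall n (b : pred nat), d (\sum_(N <= l < n | b l) u l) 0 < r.
Proof.
move=> uu r r0; apply: contrapT => /forallNP H.
have bad N : exists n, exists b : pred nat,
    ~ d (\sum_(N <= l < n | b l) u l) 0 < r.
  by have /existsNP[n /existsNP[b ?]] := H N; exists n, b.
have [nx nxP] := choice bad.
have [b bP] := choice nxP.
have nx_gt N : (N < nx N)%N.
  rewrite ltnNge; apply/negP => nN; apply: (bP N).
  by rewrite big_geq// metric_refl.
pose M k := iter k nx 0%N.
have [s s_bij sP] := @block_permutation _ u M (fun k => b (M k)) erefl
  (fun k => nx_gt (M k)).
have [x /cvg_metric sx] := uu s s_bij.
have r2 : 0 < r / 2 by rewrite divr_gt0.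
have [N Nr] := sx _ r2.
have NM : (N <= M N)%N.
  by elim: (N) => // k IH; apply: leq_ltn_trans IH (nx_gt _).
have [q Mq qE] := sP N.
apply: (bP (M N)); rewrite -[nx (M N)]/(M N.+1) -qE.
have := sub_series_geq (u \o s) Mq; rewrite /= => <-.
rewrite metricB; apply: le_lt_trans (metric_trans_le x _ _) _.
rewrite (splitr r) metricC ltrD// Nr//; exact: leq_trans Mq.
Qed.

Lemma unconditional_scale (u : nat -> X) (c : K) :
  unconditionally_convergent u ->
  unconditionally_convergent (fun l => c *: u l).
Proof.
move=> uu s s_bij; have [x sx] := uu s s_bij; exists (c *: x).
have -> : series ((fun l => c *: u l) \o s) =
    (fun y => c *: y) \o series (u \o s).
  by apply/funext => n; rewrite /series /= scaler_sumr.
have c_cont : continuous (fun y : X => c *: y).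
  move=> y; apply: (@continuous_comp X (K^o * X)%type X (fun y => (c, y))
    (fun z => z.1 *: z.2)); last exact: scale_continuous.
  by apply: (@cvg_pair _ _ _ _ (nbhs (c : K^o))); [exact: cvg_cst|exact: cvg_id].
exact: (cvg_comp _ _ sx (c_cont x)).
Qed.

(** For multipliers in [0, 1] the sum is a convex combination of subsums: split off
    the last term as t (v + u_n + ...) + (1 - t) (v + ...). The vector v carries
    the terms already split off. *)
Lemma convex_multiplier_sum (V : set X) (u : nat -> X) (t : nat -> K) N n :
  convex_set V -> (forall l, 0 <= t l <= 1) ->
  forall v, (forall b : pred nat, V (v + \sum_(N <= l < n | b l) u l)) ->
  V (v + \sum_(N <= l < n) t l *: u l).
Proof.
move=> V_convex t01; elim: n => [|n IH] v Vv.
  by have := Vv xpredT; rewrite !big_geq.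
have [nN|Nn] := ltnP n N; first by have := Vv xpredT; rewrite !big_geq.
have V0 : V (v + \sum_(N <= l < n) t l *: u l).
  apply: IH => b; have := Vv (fun l => b l && (l != n)).
  rewrite big_mkcond big_nat_recr//= eqxx andbF addr0.
  congr (V (v + _)); rewrite [RHS]big_mkcond; apply: eq_big_nat => l /andP[_ ln].
  by rewrite (ltn_eqF ln) andbT.
have V1 : V (v + u n + \sum_(N <= l < n) t l *: u l).
  apply: IH => b; have := Vv (fun l => b l || (l == n)).
  rewrite big_mkcond big_nat_recr//= eqxx orbT (addrC _ (u n)) addrA.
  congr (V (_ + _)); rewrite [RHS]big_mkcond; apply: eq_big_nat => l /andP[_ ln].
  by rewrite (ltn_eqF ln) orbF.
have /andP[t0 t1] := t01 n.
have := V_convex _ _ (Itv01 t0 t1) (mem_set V1) (mem_set V0).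
move/set_mem; rewrite big_nat_recr//=; congr V.
rewrite /conv /= /unstable.onem scalerBl scale1r addrAC scalerDr.
rewrite [RHS]addrA; set x := v + _; set y := _ *: u n; set z := _ *: x.
by rewrite [LHS]addrC -[LHS]addrA addKr.
Qed.

(** Balls of d need not be convex: the subsums are put in a convex neighbourhood
    of 0 contained in the ball. *)
Lemma unconditional_unit_multipliers (u : nat -> X) :
  unconditionally_convergent u -> forall r : R, 0 < r ->
  exists N, forall n (t : nat -> K), (forall l, 0 <= t l <= 1) ->
    d (\sum_(N <= l < n) t l *: u l) 0 < r.
Proof.
move=> uu r r0; have [B B_convex [B_open /(_ 0) B_basis]] := @locally_convex K X.
have [V [BV V0] VU] := B_basis _ (nbhs_metric_ball 0 r0).
have /nbhs_metric[r' r'0 r'V] : nbhs 0 V.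
  by apply: open_nbhs_nbhs; split=> //; exact: B_open.
have [N Nr'] := unconditional_small_subsums uu r'0.
exists N => n t t01; rewrite metricC; apply: VU.
rewrite -[X in V X]add0r; apply: (@convex_multiplier_sum V) => //.
  exact/B_convex/mem_set.
by move=> b; apply: r'V; rewrite metricC add0r.
Qed.

End InvariantMetric.

(** Reduces multipliers of modulus at most 1 to multipliers in [0, 1]: the four
    parts are the positive and negative parts of the real and imaginary parts,
    with z = i over the complex numbers and z = 0 over the reals. *)
Lemma scalar_unit_decomposition (R : realType) (s : scalars) :
  exists z : scalar_field R s, forall t : scalar_field R s, `|t| <= 1 ->
  exists a b c e : scalar_field R s,
    [/\ 0 <= a <= 1, 0 <= b <= 1, 0 <= c <= 1, 0 <= e <= 1 &
      t = (a - b) + (c - e) * z].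
Proof.
have realP (t : R) : `|t| <= 1 -> exists a b : R,
    [/\ 0 <= a <= 1, 0 <= b <= 1 & t = a - b].
  move=> t1; have [t0|t0] := leP 0 t.
    by exists t, 0; rewrite t0 lexx ler01 subr0 (le_trans (ler_norm _) t1).
  exists 0, (- t); rewrite lexx ler01 sub0r opprK oppr_ge0 (ltW t0).
  by rewrite (le_trans _ t1)// -normrN ler_norm.
case: s => /=.
  exists 0 => t /realP[a [b [a01 b01 ->]]].
  by exists a, b, 0, 0; rewrite !lexx !ler01 mulr0 addr0.
exists 'i%C => t t1.
have [a [b [a01 b01 Re_t]]] : exists a b : R,
    [/\ 0 <= a <= 1, 0 <= b <= 1 & complex.Re t = a - b].
  by apply: realP; rewrite -lecR (le_trans (normc_ge_Re t)).
have [c [e [c01 e01 Im_t]]] : exists a b : R,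
    [/\ 0 <= a <= 1, 0 <= b <= 1 & complex.Im t = a - b].
  apply: realP; rewrite -lecR -normrN -ReiNIm.
  by rewrite (le_trans (normc_ge_Re _))// normrM complexiE normCi mulr1.
exists a%:C%C, b%:C%C, c%:C%C, e%:C%C.
rewrite -!(rmorphB (real_complex R)) -Re_t -Im_t mulrC -complexE.
by split=> //; rewrite ler0c -[1]/(1%:C%C) lecR.
Qed.

Section Multipliers.
Context (R : realType) (s : scalars) (X : tvsType (scalar_field R s)).
Context (d : X -> X -> R).
Hypothesis dP : complete_invariant_metric d.

Lemma unconditional_bounded_multipliers (u : nat -> X) :
  unconditionally_convergent u -> forall r : R, 0 < r ->
  exists N, forall n0 n (t : nat -> scalar_field R s),
    (N <= n0)%N -> (forall l, `|t l| <= 1) ->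
    d (\sum_(n0 <= l < n) t l *: u l) 0 < r.
Proof.
move=> uu r r0; have [z zP] := scalar_unit_decomposition R s.
have r4 : 0 < r / 4 by rewrite divr_gt0.
have [N1 N1r] := unconditional_unit_multipliers dP uu r4.
have [N2 N2r] := unconditional_unit_multipliers dP (unconditional_scale z uu) r4.
exists (maxn N1 N2) => n0 n t; rewrite geq_max => /andP[Nn1 Nn2] t1.
have [a aP] := choice (fun l => zP _ (t1 l)).
have [b bP] := choice aP; have [c cP] := choice bP; have [e eP] := choice cP.
have cut (N : nat) (v : nat -> X) (f : nat -> scalar_field R s) :
    (N <= n0)%N -> \sum_(n0 <= l < n) f l *: v l =
    \sum_(N <= l < n) (if (n0 <= l)%N then f l else 0) *: v l.
  move=> Nn0; have [nn0|n0n] := leqP n n0.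
    rewrite big_geq// big_nat big1// => l /andP[_ ln].
    by rewrite leqNgt (leq_trans ln nn0) scale0r.
  rewrite (big_cat_nat Nn0 (ltnW n0n))/= [X in _ = X + _](_ : _ = 0) ?add0r.
    by apply: eq_big_nat => l /andP[-> _].
  by rewrite big_nat big1// => l /andP[_ ln]; rewrite leqNgt ln scale0r.
have part (N : nat) (v : nat -> X) (f : nat -> scalar_field R s) :
    (forall n (t : nat -> scalar_field R s), (forall l, 0 <= t l <= 1) ->
      d (\sum_(N <= l < n) t l *: v l) 0 < r / 4) ->
    (N <= n0)%N -> (forall l, 0 <= f l <= 1) ->
    d (\sum_(n0 <= l < n) f l *: v l) 0 < r / 4.
  move=> Nv Nn0 f01; rewrite (cut N)//; apply: Nv => l.
  by case: ifP => // _; rewrite lexx ler01.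
have -> : \sum_(n0 <= l < n) t l *: u l =
    (\sum_(n0 <= l < n) a l *: u l - \sum_(n0 <= l < n) b l *: u l) +
    (\sum_(n0 <= l < n) c l *: (z *: u l) -
     \sum_(n0 <= l < n) e l *: (z *: u l)).
  rewrite -!sumrB -big_split /=; apply: eq_bigr => l _.
  by have [_ _ _ _ ->] := eP l; rewrite !scalerA scalerDl mulrBl !scalerBl.
have := part _ _ a N1r Nn1 (fun l => let: And5 H _ _ _ _ := eP l in H).
have := part _ _ b N1r Nn1 (fun l => let: And5 _ H _ _ _ := eP l in H).
have := part _ _ c N2r Nn2 (fun l => let: And5 _ _ H _ _ := eP l in H).
have := part _ _ e N2r Nn2 (fun l => let: And5 _ _ _ H _ := eP l in H).
set A := \sum_(_ <= _ < _) _; set B := \sum_(_ <= _ < _) _.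
set C := \sum_(_ <= _ < _) _; set D := \sum_(_ <= _ < _) _.
have := metricD0 dP (D - C) (B - A).
have := metricD0 dP D (- C); have := metricD0 dP B (- A).
rewrite !(metricN dP); lra.
Qed.

(** For each j the sums with multipliers bounded by j are less than 2^-j from some
    index N j on. Letting g be j on [N j, N (j+1)[ and summing over these intervals
    gives a geometric series of errors. *)
Lemma unconditional_growth (u : nat -> X) : unconditionally_convergent u ->
  exists2 g : nat -> nat,
    forall j, exists N, forall l, (N <= l)%N -> (j <= g l)%N &
    forall r : R, 0 < r -> exists N, forall n0 n (t : nat -> scalar_field R s),
      (N <= n0)%N -> (forall l, `|t l| <= (g l)%:R) ->
      d (\sum_(n0 <= l < n) t l *: u l) 0 < r.
Proof.
move=> uu.
have step j : exists N, forall n0 n (t : nat -> scalar_field R s),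
    (N <= n0)%N -> (forall l, `|t l| <= j%:R) ->
    d (\sum_(n0 <= l < n) t l *: u l) 0 < 2 ^- j.
  have := unconditional_bounded_multipliers (unconditional_scale j%:R uu).
  have j2 : 0 < 2 ^- j :> R by rewrite invr_gt0 exprn_gt0.
  move=> /(_ _ j2)[N Nj]; exists N => n0 n t Nn0 tj.
  have -> : \sum_(n0 <= l < n) t l *: u l =
      \sum_(n0 <= l < n) (t l / j%:R) *: (j%:R *: u l).
    apply: eq_bigr => l _; rewrite scalerA; case: j tj {j2 Nj} => [|j] tj.
      by have := tj l; rewrite normr_le0 => /eqP ->; rewrite !mul0r.
    by rewrite divfK// pnatr_eq0.
  apply: Nj => // l; rewrite normrM normfV normr_nat.
  case: j tj {j2} => [|j] tj; first by rewrite invr0 mulr0 ler01.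
  by rewrite ler_pdivrMr ?mul1r// ltr0n.
have [N0 N0P] := choice step.
(* Strictly increasing, at least N0 j for j > 0, and beginning at 0 so that the
   intervals [N j, N (j+1)[ cover all the indices. *)
pose N j := (\sum_(i < j) (N0 i.+1).+1)%N.
have NS j : (N j.+1 = N j + (N0 j.+1).+1)%N by rewrite /N big_ord_recr.
have N_inc : {homo N : i j / (i <= j)%N}.
  by apply: homo_leq => //; [exact: leq_trans|move=> j; rewrite NS leq_addr].
have jN j : (j <= N j)%N.
  by elim: j => // j IH; rewrite NS addnS ltnS (leq_trans IH)// leq_addr.
pose g l := (\max_(j < l.+1 | (N j <= l)%N) j)%N.
have g_le j l : (l < N j.+1)%N -> (g l <= j)%N.
  move=> lN; apply/bigmax_leqP => i Nil; rewrite leqNgt; apply/negP => ji.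
  by have := leq_trans (N_inc _ _ ji) Nil; rewrite leqNgt lN.
exists g => [j|r r0].
  exists (N j) => l Nl; have jl : (j < l.+1)%N by rewrite ltnS (leq_trans (jN j)).
  exact: (@leq_bigmax_cond _ (fun i : 'I_l.+1 => (N i <= l)%N) _ (Ordinal jl)).
have blocks J : forall j n0 n (t : nat -> scalar_field R s),
    (0 < j)%N -> (N j <= n0)%N -> (n <= N (j + J))%N ->
    (forall l, `|t l| <= (g l)%:R) ->
    d (\sum_(n0 <= l < n) t l *: u l) 0 <= 2 * 2 ^- j.
  elim: J => [|J IH] j n0 n t j0 jn0 nJ tg.
    rewrite addn0 in nJ; rewrite big_geq ?(leq_trans nJ)// (metric_refl dP).
    by rewrite mulr_ge0// invr_ge0 exprn_ge0.
  have half : 2 * 2 ^- j.+1 = 2 ^- j :> R.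
    by rewrite exprS invfM mulrA divff ?mul1r.
  have first_block m : (m <= N j.+1)%N ->
      d (\sum_(n0 <= l < m) t l *: u l) 0 <= 2 ^- j.
    move=> mN; apply: ltW.
    have -> : \sum_(n0 <= l < m) t l *: u l =
        \sum_(n0 <= l < m) (if (l < m)%N then t l else 0) *: u l.
      by apply: eq_big_nat => l /andP[_ ->].
    apply: N0P => [|l].
      apply: leq_trans jn0; case: j j0 {IH nJ half mN} => // j _.
      by rewrite NS; lia.
    case: ifP => [lm|_]; last by rewrite normr0.
    by rewrite (le_trans (tg l))// ler_nat g_le// (leq_trans lm).
  have [Nn0|n0N] := leqP (N j.+1) n0.
    apply: le_trans (IH j.+1 n0 n t _ Nn0 _ tg) _ => //; first by rewrite addSnnS.
    by rewrite half mulr_natl mulr2n lerDl invr_ge0 exprn_ge0.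
  have [nN|Nn] := leqP n (N j.+1).
    apply: le_trans (first_block n nN) _.
    by rewrite mulr_natl mulr2n lerDl invr_ge0 exprn_ge0.
  rewrite (big_cat_nat (ltnW n0N) (ltnW Nn))/=.
  apply: le_trans (metricD0 dP _ _) _.
  rewrite mulr_natl mulr2n lerD ?first_block// -half.
  by apply: IH => //; rewrite addSnnS.
have [j rj] : exists j, 2 * 2 ^- j.+1 < r.
  have [j rj] : exists j, 2 ^- j < r.
    have [j _ /(_ j (leqnn j))] := near_infty_natSinv_expn_lt (PosNum r0).
    by rewrite /= div1r; exists j.
  exists j; by rewrite exprS invfM mulrA divff ?mul1r.
exists (N j.+1) => n0 n t Nn0 tg.
apply: le_lt_trans rj; apply: (@blocks n) => //.
by rewrite (leq_trans (jN n))// N_inc// leq_addl.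
Qed.
End Multipliers.

(** * Coefficients of the common vector *)

(** The weights and constants are taken in K, the images of the real ones: only
    their moduli matter. *)
Section Coefficients.
Context (K : numFieldType) (W : nat -> nat -> K) (om : nat -> K) (M eta C : K).
Context (r : nat).
Hypothesis W_neq0 : forall i j, W i j != 0.
Hypotheses (M_ge1 : 1 <= M) (eta_gt0 : 0 < eta) (eta_le1 : eta <= 1).
Hypotheses (C_gt0 : 0 < C) (M_eta : M ^+ 2 * eta ^+ r <= 1).
Hypothesis om_W : forall i n m, (1 <= m)%N ->
  `|\prod_(n <= k < (n + m).+1) om k|
    <= C * eta ^+ m * `|\prod_(n <= k < (n + m).+1) W i k|.
Hypothesis W_bounds : forall i n m, (1 <= m)%N ->
  C^-1 * M ^- m <= `|\prod_(n <= k < (n + m).+1) W i k| <= C * M ^+ m.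

Local Notation Om l := (\prod_(1 <= j < l.+1) om j).

Lemma prod_neq0 (v : nat -> K) a b : (forall j, v j != 0) ->
  \prod_(a <= j < b) v j != 0.
Proof. by move=> v0; rewrite prodf_seq_neq0; apply/allP => j _ /=. Qed.

(** This is (ii) on ]k, l], with the product of omega written Omega_l / Omega_k;
    (ii) concerns products of at least two factors, whence k + 2 <= l. *)
Lemma om_over_W i k l : (k.+2 <= l)%N ->
  `|Om l| <= C * eta ^+ (l - k.+1) * `|\prod_(k.+1 <= j < l.+1) W i j| * `|Om k|.
Proof.
move=> kl; have kl' : (k.+1 <= l.+1)%N by lia.
rewrite (@big_cat_nat _ _ _ k.+1 1 l.+1)//= normrM mulrC ler_wpM2r//.
have := @om_W i k.+1 (l - k.+1) _; rewrite subnKC; last by lia.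
by apply; rewrite subn_gt0.
Qed.

(** The upper bound of (iii) for i against its lower bound for j; with n factors,
    the exponent is n - 1. *)
Lemma W_ratio i j l n : (2 <= n)%N ->
  `|\prod_(l.+1 <= k < (l + n).+1) W i k| <=
    C ^+ 2 * M ^+ (2 * n.-1) * `|\prod_(l.+1 <= k < (l + n).+1) W j k|.
Proof.
move=> n2; have n1 : (1 <= n.-1)%N by lia.
have M_gt0 : 0 < M by exact: lt_le_trans M_ge1.
have -> : (l + n).+1 = (l.+1 + n.-1).+1 by lia.
have /andP[_ up] := @W_bounds i l.+1 _ n1.
have /andP[lo _] := @W_bounds j l.+1 _ n1.
apply: le_trans up _; rewrite -mulrA.
have -> : C * M ^+ n.-1 = C ^+ 2 * (M ^+ (2 * n.-1) * (C^-1 * M ^- n.-1)).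
  rewrite mulnC exprM expr2 (expr2 (M ^+ _)).
  have := lt0r_neq0 C_gt0; have := lt0r_neq0 (exprn_gt0 n.-1 M_gt0).
  by set z := M ^+ _ => z0 C0; field; rewrite z0.
by rewrite ler_wpM2l ?exprn_ge0 ?(ltW C_gt0)// ler_wpM2l// exprn_ge0// ltW.
Qed.

Context (op deg N : nat -> nat) (y : nat -> nat -> K) (A : nat -> set nat).
Context (g : nat -> nat).
Hypotheses (N_ge2 : forall c, (2 <= N c)%N).
Hypotheses (deg_N : forall c, (deg c <= N c)%N).
Hypothesis A_ge : forall c n, A c n -> (N c <= n)%N.
Hypothesis A_disjoint : forall c c' n, A c n -> A c' n -> c = c'.
Hypothesis A_gap : forall c c' n m, A c n -> A c' m -> (n < m)%N ->
  (n + maxn (N c) (N c') <= m)%N.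
Hypothesis A_ratio : forall c c' n m, A c n -> A c' m -> (n < m)%N ->
  c != c' -> (r.+1 * n <= m)%N.

(* D c bounds the coefficients, multiplied by Omega_l, of every B_i^n S_(op c)^m Y_c
   that occurs: C is the bound within a single operator, and C^3 the one between
   two different operators. *)
Let D c := (C + C ^+ 3) * \sum_(k < deg c) (`|y c k| * `|Om k|).
Hypothesis D_le : forall c l, (N c <= l)%N -> D c <= (g l)%:R.

(** The coefficients of \sum_c \sum_(m in A c) S_(op c)^m Y_c. As deg c <= N c, the
    gaps of A make the supports [m, m + deg c[ disjoint, so each coordinate gets
    its value from at most one pair (c, m). *)
Lemma block_coefficients : exists a : nat -> K,
  (forall c m k, A c m -> (k < deg c)%N ->
    a (m + k)%N = y c k / \prod_(k.+1 <= j < (m + k).+1) W (op c) j) /\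
  (forall l, a l != 0 -> exists c m k, [/\ A c m, (k < deg c)%N & l = (m + k)%N]).
Proof.
have decode_uniq c c' m m' k k' : A c m -> A c' m' -> (k < deg c)%N ->
    (k' < deg c')%N -> (m + k = m' + k')%N -> [/\ c = c', m = m' & k = k'].
  move=> Am Am' kc kc' E.
  have mm' : m = m'.
    have := deg_N c; have := deg_N c'; case: (ltngtP m m') => // lt_m.
      by have := A_gap Am Am' lt_m; lia.
    by have := A_gap Am' Am lt_m; lia.
  by split=> //; [rewrite mm' in Am; exact: A_disjoint Am Am'|lia].
pose P l x := (forall c m k, A c m -> (k < deg c)%N -> l = (m + k)%N ->
    x = y c k / \prod_(k.+1 <= j < l.+1) W (op c) j) /\
  (x != 0 -> exists c m k, [/\ A c m, (k < deg c)%N & l = (m + k)%N]).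
have P_ex l : exists x, P l x.
  have [[c [m [k [Am kc E]]]]|none] :=
      pselect (exists c m k, [/\ A c m, (k < deg c)%N & l = (m + k)%N]).
    exists (y c k / \prod_(k.+1 <= j < l.+1) W (op c) j); split.
      move=> c' m' k' Am' kc' E'; rewrite E in E'.
      by have [-> _ ->] := decode_uniq _ _ _ _ _ _ Am Am' kc kc' E'.
    by move=> _; exists c, m, k.
  exists 0; split; last by rewrite eqxx.
  by move=> c m k Am kc E; exfalso; apply: none; exists c, m, k.
have [a aP] := choice P_ex.
exists a; split=> [c m k Am kc|l]; last by have [_] := aP l.
by have [aE _] := aP (m + k)%N; exact: aE Am kc erefl.
Qed.

(** The coefficient at l of B_i^n S_j^m Y_q, where l + n = m + k. The factors over
    ]l, l + n] cancel if i = j; otherwise their quotient rho is at most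
    C^2 M^(2(n-1)) = C^2 (M^2)^(n-1), absorbed by eta^(r(n-1)), a part of the decay
    eta^(l-k-1) supplied by ]k, l]. *)
Lemma shifted_coefficient_bound i j q k l n :
  (k < deg q)%N -> (k.+2 <= l)%N ->
  i = j \/ (2 <= n)%N /\ (r * n.-1 <= l - k.+1)%N ->
  `|\prod_(l.+1 <= h < (l + n).+1) W i h *
    (y q k / \prod_(k.+1 <= h < (l + n).+1) W j h) * Om l| <= D q.
Proof.
move=> kq kl ij.
have C0 := ltW C_gt0; have eta0 := ltW eta_gt0.
have M0 : 0 <= M by exact: le_trans ler01 M_ge1.
set P := \prod_(l.+1 <= h < _) W i h.
set Q := \prod_(l.+1 <= h < (l + n).+1) W j h.
set T := \prod_(k.+1 <= h < l.+1) W j h.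
have -> : \prod_(k.+1 <= h < (l + n).+1) W j h = T * Q.
  by rewrite (@big_cat_nat _ _ _ l.+1)//=; lia.
have Q_gt0 : 0 < `|Q| by rewrite normr_gt0 prod_neq0.
have T_gt0 : 0 < `|T| by rewrite normr_gt0 prod_neq0.
have [rho [rho0 PQ rhoC]] : exists rho, [/\ 0 <= rho, `|P| <= rho * `|Q| &
    rho * (C * eta ^+ (l - k.+1)) <= C + C ^+ 3].
  case: ij => [ij|[n2 rn]].
    exists 1; rewrite ler01 !mul1r /P /Q ij lexx; split=> //.
    apply: (@le_trans _ _ C); last by rewrite lerDl exprn_ge0.
    by rewrite ler_piMr// exprn_ile1.
  exists (C ^+ 2 * M ^+ (2 * n.-1)); split; last 1 first.
  - apply: (@le_trans _ _ (C ^+ 3)); last by rewrite lerDr.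
    rewrite mulrACA -exprSr ler_piMr ?exprn_ge0//.
    rewrite -(subnK rn) exprD mulrCA exprM (exprM eta) -exprMn.
    by rewrite mulr_ile1 ?exprn_ile1 ?mulr_ge0 ?exprn_ge0 ?mulr_ge0 ?exprn_ge0.
  - by rewrite mulr_ge0 ?exprn_ge0.
  - exact: W_ratio.
have := @om_over_W j k l kl; rewrite -/T.
rewrite !normrM normfV normrM invfM.
set z := `|y q k|; set u := `|Om k|; set e := C * _ in rhoC * => OmT.
apply: (@le_trans _ _ (rho * e * (z * u))).
  have -> : rho * e * (z * u) = (rho * `|Q|) * (z * (`|T|^-1 * `|Q|^-1)) * (e * `|T| * u).
    by field; rewrite (lt0r_neq0 Q_gt0) (lt0r_neq0 T_gt0).
  apply: ler_pM => //; first by rewrite !mulr_ge0 ?invr_ge0// normr_ge0.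
  by apply: ler_pM => //; rewrite !mulr_ge0 ?invr_ge0// normr_ge0.
apply: ler_pM => //; [by rewrite !mulr_ge0 ?exprn_ge0| by rewrite mulr_ge0 ?normr_ge0|].
by rewrite (bigD1 (Ordinal kq))//= lerDl sumr_ge0.
Qed.

(** The bounds on a and on the b l beyond deg c say that the expansions of x and of
    B_(op c)^n x - Y_c are among those with uniformly small tails; the latter starts
    at N c, since m - n >= N c for the pairs that contribute. *)
Lemma universal_coefficients : exists a : nat -> K,
  (forall l, `|a l * Om l| <= (g l)%:R) /\
  forall c n, A c n ->
    let b l := \prod_(l.+1 <= j < (l + n).+1) W (op c) j * a (l + n)%N in
    [/\ forall l, (l < deg c)%N -> b l = y c l,
        forall l, (deg c <= l < N c)%N -> b l = 0 &
        forall l, (deg c <= l)%N -> `|b l * Om l| <= (g l)%:R].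
Proof.
have [a [aE a_supp]] := block_coefficients; exists a; split=> [l|c n An b].
  have [->|/a_supp[q [m [k [Am kq lE]]]]] := eqVneq (a l) 0.
    by rewrite mul0r normr0 ler0n.
  have Nm := A_ge Am; have := N_ge2 q => N2.
  have Nl : (N q <= l)%N by lia.
  rewrite {1}lE (aE _ _ _ Am kq) -lE; apply: le_trans (D_le Nl).
  have kl : (k.+2 <= l)%N by lia.
  have := @shifted_coefficient_bound (op q) (op q) q k l 0 kq kl (or_introl erefl).
  by rewrite addn0 big_geq// mul1r.
have later l : (deg c <= l)%N -> b l != 0 -> exists q m k,
    [/\ A q m, (k < deg q)%N, (l + n = m + k)%N & (n < m)%N].
  move=> cl; rewrite mulf_eq0 negb_or => /andP[_ /a_supp[q [m [k [Am kq E]]]]].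
  exists q, m, k; split=> //; rewrite ltnNge leq_eqVlt; apply/negP => /predU1P[mn|mn].
    have qc : q = c by rewrite mn in Am; exact: A_disjoint Am An.
    by move: kq; rewrite qc; lia.
  by have := A_gap Am An mn; have := deg_N q; lia.
split=> [l lc|l /andP[cl lN]|l cl].
- rewrite /b addnC (aE _ _ _ An lc); set p := \prod_(_ <= _ < _) _.
  by rewrite mulrC divfK// prod_neq0.
- apply/eqP/negP => /negP /(later _ cl)[q [m [k [Am kq E nm]]]].
  by have := A_gap An Am nm; have := leq_maxl (N c) (N q); lia.
have [->|/(later _ cl)[q [m [k [Am kq E nm]]]]] := eqVneq (b l) 0.
  by rewrite mul0r normr0 ler0n.
have gap := A_gap An Am nm; have Nq := leq_maxr (N c) (N q).
have N2q := N_ge2 q; have N2c := N_ge2 c; have Nn := A_ge An.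
have Nl : (N q <= l)%N by lia.
apply: le_trans (D_le Nl).
have kl : (k.+2 <= l)%N by lia.
have := @shifted_coefficient_bound (op c) (op q) q k l n kq kl.
rewrite /b E (aE _ _ _ Am kq) -E; apply.
have [->|cq] := eqVneq c q; [by left|right; split; first by lia].
by have := A_ratio An Am nm cq; nia.
Qed.

End Coefficients.

(** * Scalars, dense finite combinations and iterated shifts *)

Section OfReal.
Context (R : realType) (s : scalars).
Local Notation K := (scalar_field R s).

Lemma of_real_rmorphism :
  exists f : {rmorphism R -> K}, (f : R -> K) = @of_real R s.
Proof. by case: s; [exists idfun|exists (real_complex R)]. Qed.

Lemma of_real_prod (F : nat -> R) a b :
  of_real s (\prod_(a <= j < b) F j) = \prod_(a <= j < b) of_real s (F j).
Proof. by have [f <-] := of_real_rmorphism; rewrite rmorph_prod. Qed.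

Lemma of_realV (x : R) : of_real s x^-1 = (of_real s x)^-1.
Proof. by have [f <-] := of_real_rmorphism; rewrite fmorphV. Qed.

Lemma of_realM (x y : R) : of_real s (x * y) = of_real s x * of_real s y.
Proof. by have [f <-] := of_real_rmorphism; rewrite rmorphM. Qed.

Lemma of_realX (x : R) n : of_real s (x ^+ n) = of_real s x ^+ n.
Proof. by have [f <-] := of_real_rmorphism; rewrite rmorphXn. Qed.

Lemma of_real1 : of_real s (1 : R) = 1.
Proof. by have [f <-] := of_real_rmorphism; rewrite rmorph1. Qed.

Lemma of_real0 : of_real s (0 : R) = 0.
Proof. by have [f <-] := of_real_rmorphism; rewrite rmorph0. Qed.

Lemma of_real_eq0 (x : R) : (of_real s x == 0) = (x == 0).
Proof. by have [f <-] := of_real_rmorphism; rewrite fmorph_eq0. Qed.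

Lemma ler_of_real (x y : R) : (of_real s x <= of_real s y) = (x <= y).
Proof. by case: s => //=; rewrite lecR. Qed.

Lemma ltr_of_real (x y : R) : (of_real s x < of_real s y) = (x < y).
Proof. by case: s => //=; rewrite ltcR. Qed.

Lemma normr_of_real (x : R) : `|of_real s x| = of_real s `|x|.
Proof. by case: s => //=; rewrite normc_def/= expr0n addr0 sqrtr_sqr. Qed.

Lemma scalar_archimedean (z : K) : exists n, `|z| <= n%:R.
Proof.
have archi (x : R) : exists n, x <= n%:R.
  exists (Num.Def.archi_bound `|x|); rewrite (le_trans (ler_norm _))// ltW//.
  exact/archi_boundP.
case: s z => /= z; first exact: archi.
have [n zn] := archi (Num.sqrt (complex.Re z ^+ 2 + complex.Im z ^+ 2)).
by exists n; rewrite normc_def -(rmorph_nat (real_complex R)) lecR.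
Qed.
End OfReal.

(** This is where the alternative on (M, eta) is used: if M > 1 then eta < 1, and
    powers of eta compensate any fixed power of M. *)
Lemma geometric_domination (R : realType) (M eta : R) : 1 <= M ->
  0 < eta <= 1 -> (M = 1 /\ eta = 1) \/ (M <> 1 /\ eta <> 1) ->
  exists r, M ^+ 2 * eta ^+ r <= 1.
Proof.
move=> M1 /andP[eta0 eta1] [[-> ->]|[_ /eqP eta_neq1]].
  by exists 0%N; rewrite !expr1n mul1r.
have eta_lt1 : `|eta| < 1 by rewrite gtr0_norm// lt_neqAle eta_neq1.
have M2 : 0 < M ^+ 2 by rewrite exprn_gt0// (lt_le_trans ltr01).
have := @cvg_expr R eta eta_lt1 => /cvgrPdist_lt /(_ (M ^+ 2)^-1).
rewrite invr_gt0 => /(_ M2)[r _ /(_ r (leqnn r))]; rewrite sub0r normrN.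
move=> /ltW eta_r; exists r.
rewrite mulrC -ler_pdivlMr// div1r; apply: le_trans eta_r; exact: ler_norm.
Qed.

Lemma injective_unbounded (f : nat -> nat) : injective f ->
  forall c, exists r, (c <= f r)%N.
Proof.
move=> f_inj c; apply: contrapT => /forallNP small.
have f_lt r : (f r < c)%N by rewrite ltnNge; apply/negP; exact: small.
pose h (k : 'I_c.+1) : 'I_c := Ordinal (f_lt k).
have h_inj : injective h by move=> k l /(congr1 val)/= /f_inj; exact: val_inj.
by have := leq_card h h_inj; rewrite !card_ord ltnn.
Qed.

Section Approximation.
Context (R : realType) (K : numFieldType) (X : tvsType K) (d : X -> X -> R).
Hypothesis dP : complete_invariant_metric d.
Context (e : nat -> X).
Hypothesis e_expand : forall x, exists a, expansion e a x.

(** Partial sums of the expansions of the points of a countable dense set are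
    dense. A code is a quadruple (operator, point, length, repetition index); the
    last component only makes each triple recur for arbitrarily large codes. *)
Lemma dense_finite_expansions : separable X ->
  exists op deg : nat -> nat, exists y : nat -> nat -> K,
  forall i z (rho : R) c0, 0 < rho -> exists c,
    [/\ (c0 <= c)%N, op c = i &
        d z (\sum_(0 <= k < deg c) y c k *: e k) < rho].
Proof.
move=> [D /countable_injP[f f_inj] D_dense].
have enum n : exists x, (exists2 x', D x' & f x' = n) -> D x /\ f x = n.
  have [[x Dx fx]|no] := pselect (exists2 x', D x' & f x' = n); first by exists x.
  by exists 0.
have [q qP] := choice enum.
have qf x : D x -> q (f x) = x.
  move=> Dx; have [Dq fq] := qP (f x) (ex_intro2 _ _ x Dx erefl).
  by apply: f_inj => //; exact: mem_set.
have [al alP] := choice (fun n => e_expand (q n)).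
pose decode c : nat * nat * nat * nat := odflt (0, 0, 0, 0)%N (unpickle c).
exists (fun c => (decode c).1.1.1), (fun c => (decode c).1.2).
exists (fun c => al (decode c).1.1.2) => i z rho c0 rho0.
have rho2 : 0 < rho / 2 by rewrite divr_gt0.
have [x [Dx xz]] : exists x, D x /\ d z x < rho / 2.
  have /nbhs_interior zU := nbhs_metric_ball dP z rho2.
  have [|x [Ux Dx]] := D_dense _ _ (open_interior [set y | d z y < rho / 2]).
    by exists z; exact: nbhs_singleton zU.
  by exists x; split=> //; exact: (interior_subset Ux).
have [L LP] := (cvg_metric dP _ _).1 (alP (f x)) _ rho2.
have code_inj : injective (fun r : nat => pickle (i, f x, L, r)).
  by move=> r r' /= E; have [] := pcan_inj (@pickleK _) E.
have [r c0r] := injective_unbounded code_inj c0.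
exists (pickle (i, f x, L, r)); rewrite /decode pickleK; split=> //=.
apply: le_lt_trans (metric_trans_le dP x _ _) _.
rewrite (splitr rho) ltrD//.
by have := LP L (leqnn L); rewrite qf.
Qed.

End Approximation.

Lemma iter_weighted_shift (R : realType) (s : scalars)
    (X : tvsType (scalar_field R s)) (e : nat -> X) (w : nat -> R)
    (B : X -> X) (a : nat -> scalar_field R s) (x : X) n :
  is_weighted_shift e w B -> expansion e a x ->
  expansion e (fun l => \prod_(l.+1 <= j < (l + n).+1) of_real s (w j) *
    a (l + n)%N) (iter n B x).
Proof.
move=> BP ax; elim: n => [|n IH] /=.
  rewrite (_ : (fun l => _) = a)//; apply/funext => l.
  by rewrite addn0 big_geq// mul1r.
rewrite (_ : (fun l => _) = (fun l => of_real s (w l.+1) *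
  (\prod_(l.+2 <= j < (l.+1 + n).+1) of_real s (w j) * a (l.+1 + n)%N))).
  exact: (BP _ _ IH).
apply/funext => l; rewrite -addSnnS mulrA; congr (_ * _).
by rewrite big_ltn//; lia.
Qed.

Theorem theorem2p17 (R : realType) (s : scalars)
    (X : tvsType (scalar_field R s)) (e : nat -> X)
    (w : nat -> nat -> R) (B : nat -> {linear X -> X})
    (omega : nat -> R) (M eta C : R) :
  frechet R X ->
  separable X ->
  unconditional_basis e ->
  (forall i, weight (w i)) ->
  (forall i, is_weighted_shift e (w i) (B i)) ->
  (forall i, continuous (B i)) ->
  weight omega ->
  1 <= M ->
  0 < eta <= 1 ->
  (M = 1 /\ eta = 1) \/ (M <> 1 /\ eta <> 1) ->
  0 < C ->
  unconditionally_convergent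
    (fun k => of_real s (\prod_(1 <= j < k.+2) omega j)^-1 *: e k.+1) ->
  (forall i n m : nat, (1 <= m)%N ->
    `|\prod_(n <= k < (n + m).+1) omega k|
      <= C * eta ^+ m * `|\prod_(n <= k < (n + m).+1) w i k|) ->
  (forall i n m : nat, (1 <= m)%N ->
    C^-1 * M ^- m <= `|\prod_(n <= k < (n + m).+1) w i k| <= C * M ^+ m) ->
  exists x : X, forall i, frequently_hypercyclic R (B i) x.
Proof.
move=> [d dP] X_sep [e_basis _] w_neq0 B_shift _ omega_neq0 M_ge1 eta01 M_eta C_gt0.
move=> omega_conv omega_w w_bounds.
have e_expand x : exists a, expansion e a x by have [a [] ] := e_basis x; exists a.
have [r Mr] := geometric_domination M_ge1 eta01 M_eta.
have [op [deg [y y_dense]]] := dense_finite_expansions dP e_expand X_sep.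
pose W i j := of_real s (w i j); pose om j := of_real s (omega j).
pose Om l := \prod_(1 <= j < l.+1) om j.
have W_neq0 i j : W i j != 0 by rewrite of_real_eq0 w_neq0.
have om_neq0 j : om j != 0 by rewrite of_real_eq0 omega_neq0.
have Om_neq0 l : Om l != 0 by exact: prod_neq0.
have [g0 g0_unbounded g0_small] := unconditional_growth dP omega_conv.
(* The series of the e_l / Omega_l starts at l = 1, hence the shift of index. *)
pose g l := g0 l.-1.
have tail_small (eps : R) : 0 < eps -> exists L, forall n0 n c, (L <= n0)%N ->
    (forall l, `|c l * Om l| <= (g l)%:R) ->
    d (\sum_(n0 <= l < n) c l *: e l) 0 < eps.
  move=> /g0_small[L LP]; exists L.+1 => -[//|n0] n c Ln0 cg.
  rewrite big_add1 (_ : \sum_(_ <= _ < _) _ = \sum_(n0 <= l < n.-1)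
    (c l.+1 * Om l.+1) *: (of_real s (\prod_(1 <= j < l.+2) omega j)^-1 *: e l.+1)).
    by apply: LP => // l; exact: cg.
  apply: eq_bigr => l _; rewrite scalerA of_realV of_real_prod -/(Om l.+1).
  by rewrite mulfK.
pose D c := (of_real s C + of_real s C ^+ 3) *
  \sum_(k < deg c) (`|y c k| * `|Om k|).
have N_ex c : exists N, [/\ (2 <= N)%N, (deg c <= N)%N, (c <= N)%N &
    forall l, (N <= l)%N -> D c <= (g l)%:R].
  have D_ge0 : 0 <= D c.
    rewrite mulr_ge0 ?addr_ge0 ?exprn_ge0 -?of_real0 ?ler_of_real ?(ltW C_gt0)//.
    by rewrite of_real0 sumr_ge0// => k _; rewrite mulr_ge0.
  have [n Dn] := scalar_archimedean (D c); rewrite ger0_norm// in Dn.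
  have [L LP] := g0_unbounded n.
  exists (maxn 2 (maxn (deg c) (maxn c L.+1))); split; [lia|lia|lia|] => l Nl.
  by rewrite (le_trans Dn)// ler_nat LP//; lia.
have [N NP] := choice N_ex.
pose a := maxn 4 (2 * r.+1); have a4 : (4 <= a)%N by rewrite leq_maxl.
pose A := sparse_set a N.
have [] := @universal_coefficients _ W om (of_real s M) (of_real s eta) (of_real s C)
  r W_neq0 _ _ _ _ _ _ _ op deg N y A g.
- by rewrite -of_real1 ler_of_real.
- by rewrite -of_real0 ltr_of_real; case/andP: eta01.
- by rewrite -of_real1 ler_of_real; case/andP: eta01.
- by rewrite -of_real0 ltr_of_real.
- by rewrite -!of_realX -of_realM -of_real1 ler_of_real.
- move=> i n m m1; rewrite -!of_real_prod !normr_of_real.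
  by rewrite -of_realX -!of_realM ler_of_real omega_w.
- move=> i n m m1; rewrite -of_real_prod normr_of_real.
  by rewrite -of_realX -!of_realV -!of_realM !ler_of_real w_bounds.
- by move=> c; have [] := NP c.
- by move=> c; have [] := NP c.
- by move=> c n; exact: sparse_set_ge.
- by move=> c c' n; exact: sparse_set_disjoint.
- by move=> c c' n m; exact: sparse_set_gap.
- move=> c c' n m An Am nm cc'.
  by have := sparse_set_ratio a4 An Am nm cc'; have := leq_maxr 4 (2 * r.+1); rewrite -/a; nia.
- by move=> c; have [] := NP c.
move=> al [al_le al_b].
have [x x_al] : exists x, expansion e al x.
  apply: (metric_complete dP) => eps /tail_small[L LP]; exists L => m n Lm mn.
  rewrite -(metricB dP) sub_series_geq//; exact: LP.
exists x => i U U_open [z Uz].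
have [rho rho0 rhoU] := (nbhs_metric dP _ _).1 (open_nbhs_nbhs (conj U_open Uz)).
have rho3 : 0 < rho / 3 by rewrite divr_gt0.
have [L LP] := tail_small _ rho3.
have [c [Lc opc zc]] := y_dense i z _ L rho3.
have [N2 degN cN _] := NP c.
apply: lt_le_trans (sparse_set_lower_density N a4 R c) _.
apply: lower_density_subset => n An /=; apply: rhoU.
pose b l := \prod_(l.+1 <= j < (l + n).+1) W (op c) j * al (l + n)%N.
have [b_y b_0 b_g] : [/\ forall l, (l < deg c)%N -> b l = y c l,
    forall l, (deg c <= l < N c)%N -> b l = 0 &
    forall l, (deg c <= l)%N -> `|b l * Om l| <= (g l)%:R] := al_b c n An.
have b_exp : expansion e b (iter n (B (op c)) x).
  exact: iter_weighted_shift (B_shift (op c)) x_al.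
have [n1 n1P] := (cvg_metric dP _ _).1 b_exp _ rho3.
pose n2 := maxn n1 (N c).
(* tail_small wants a bound at every index, and the terms before deg c, which
   form Y_c, have none. *)
pose b' l := if (l < deg c)%N then 0 else b l.
have tail : d (\sum_(N c <= l < n2) b' l *: e l) 0 < rho / 3.
  apply: LP => [|l]; first exact: leq_trans cN.
  rewrite /b'; case: ltnP => [_|/b_g//].
  by rewrite mul0r normr0 ler0n.
set S := series (fun l => b l *: e l) n2.
set Y := \sum_(0 <= k < deg c) y c k *: e k in zc.
have bE : S - Y = \sum_(N c <= l < n2) b' l *: e l.
  apply/eqP; rewrite subr_eq addrC; apply/eqP.
  rewrite /S /series /= (big_cat_nat (leq0n (N c)) (leq_maxr _ _))/=.
  rewrite (big_cat_nat (leq0n (deg c)) degN)/=.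
  rewrite [X in _ + X + _](_ : _ = 0) ?addr0; last first.
    by rewrite big_nat big1// => l /b_0 ->; rewrite scale0r.
  congr (_ + _); apply: eq_big_nat => l; first by move=> /b_y ->.
  by move=> /andP[Nl _]; rewrite /b' ltnNge (leq_trans degN Nl).
have SB := n1P n2 (leq_maxl _ _).
rewrite -bE (metricB dP) in tail.
have := metric_trans_le dP S Y (iter n (B (op c)) x).
have := metric_trans_le dP Y z (iter n (B (op c)) x).
rewrite (metricC dP Y S) (metricC dP S (iter _ _ _)) -opc; rewrite -/S in SB; lra.
Qed.
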